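(* Let $\{\chi'_{n,m}\}_{n\in\mathbb{N},\,m\le n}$ be the collection of independent, partially observed and imputed random elements of $H=L^2([0,1],\mathcal{B}([0,1]),\mu)$ described in the context. If there exists $\delta'>0$ such that $\lim_{n\to\infty}\sum_{m=1}^n\mathbb{E}'_{n,m}\big[\|\chi'_{n,m}\|_{L^2(\mu)}^{2+\delta'}\big]=0$, then for every $\varepsilon>0$, $$\lim_{n\to\infty}\sum_{m=1}^n\mathbb{E}'_{n,m}\big[\|\chi'_{n,m}\|_{L^2(\mu)}^2 : \|\chi'_{n,m}\|_{L^2(\mu)}>\varepsilon\big]=0.$$
   Context: Complete data. $\mu$ is Lebesgue measure on $[0,1]$ and $H=L^2([0,1],\mathcal{B}([0,1]),\mu)$ is the real separable Hilbert space. $\{\chi_{n,m}\}_{n\in\mathbb{N},\,m\le n}$ is a collection of independent random elements of $H$; $\chi_{n,m}:\Omega\times[0,1]\to\mathbb{R}$ is defined on the probability space $(\Omega,\mathcal{F},P_{n,m})$, where $\Omega$ is separable, and $\mu$ is independent of $P_{n,m}$. $\mathbb{E}_{n,m}$ denotes expectation (Bochner integral) under $P_{n,m}$. It is assumed that $\mathbb{E}_{n,m}[\chi_{n,m}(w,\cdot)]=\mathbf{0}$ and $\int_{\Omega\times[0,1]^2}|\chi_{n,m}(w,x)\chi_{n,m}(w,y)|\,d(P_{n,m}\times\mu\times\mu)<\infty$ for all $n,m$. Missingness. $\mathcal{M}$ is a measure space over $\{0,1\}^{[0,1]}$ (the space of missingness patterns) with probability measures $\nu_{n,m}$, independent of $\mu$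 but not necessarily independent of $P_{n,m}$; $\nu_{n,m}(\cdot\mid w)$ is the conditional law of the pattern given $w\in\Omega$. For $M\in\mathcal{M}$ put $X_1(M)=\{x\in[0,1]:M(x)=1\}$ (observed points) and $X_0(M)=\{x\in[0,1]:M(x)=0\}$ (missing points). Imputed data. $\{\chi'_{n,m}\}_{n\in\mathbb{N},\,m\le n}$ is a collection of independent random elements of $H$, with $\chi'_{n,m}$ depending on $(w,M)\in\Omega\times\mathcal{M}$ under the joint law of $P_{n,m}$ and $\nu_{n,m}$, given by $$\chi'_{n,m}(w,M,\cdot)=\chi_{n,m}(w,\cdot)\mathbb{1}_{X_1(M)}+\big(\mathbb{E}_{n,m}[\chi_{n,m}(w',\cdot)\mid w,M]+\mathcal{G}(0,\mathcal{K}^{w,M}_{n,m})(\cdot)\big)\mathbb{1}_{X_0(M)}.$$ The observed part is $O(\chi'_{n,m}(w,M,\cdot))=\chi'_{n,m}(w,M,\cdot)|_{X_1(M)}$. The notation $\mathbb{E}_{n,m}[\,\cdot\mid w,M]$ means $\mathbb{E}_{n,m}[\,\cdot\mid O(\chi'_{n,m}(w',M,\cdot))=O(\chi'_{n,m}(w,M,\cdot))]$, the conditional expectation over $w'\in\Omega$ under $P_{n,m}$ given that the observed part under $w'$ and pattern $M$ agrees with that under $w$. $\mathcal{G}(0,\mathcal{K}^{w,M}_{n,m})$ is a realization, drawn given $(w,M)$, of a Gaussian process centered at $\mathbf{0}$ with covariance $\mathcal{K}^{w,M}_{n,m}$, the conditional covariance of $\chi_{n,m}(w',\cdot)$ given $O(\chi'_{n,m}(w',M,\cdot))=O(\chi'_{n,m}(w,M,\cdot))$.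 $\mathbb{E}'_{n,m}$ denotes expectation with respect to the joint law of $(w,M)$ on $\Omega\times\mathcal{M}$ and the Gaussian draw. Missing at Random (MAR) assumption: for all $n$, $m\le n$, $w_1,w_2\in\Omega$ and $M\in\mathcal{M}$ with $O(\chi'_{n,m}(w_1,M,\cdot))=O(\chi'_{n,m}(w_2,M,\cdot))$, one has $\nu_{n,m}(M\mid w_1)=\nu_{n,m}(M\mid w_2)$. For a random variable $X$ and an event $A$, $\mathbb{E}[X:A]$ denotes $\mathbb{E}[X\mathbb{1}_A]$. *)

(* Defs.v *)
From HB Require Import structures.
From mathcomp Require Import all_boot all_order all_algebra.
From mathcomp Require Import all_classical all_reals all_analysis.

Set Implicit Arguments.
Unset Strict Implicit.
Unset Printing Implicit Defensive.
Import Order.TTheory GRing.Theory Num.Theory.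
Import numFieldNormedType.Exports.

Local Open Scope classical_set_scope.
Local Open Scope ring_scope.

Section unit_interval.
Context (R : realType).

Definition I01_carrier : Type := {x : R | 0 <= x <= 1}.

HB.instance Definition _ := [Choice of I01_carrier by <:].

Let zero01 : 0 <= (0 : R) <= 1. Proof. by rewrite lexx ler01. Qed.

HB.instance Definition _ :=
  isPointed.Build I01_carrier (exist _ 0 zero01 : I01_carrier).

Definition I01_val (x : I01_carrier) : measurableTypeR R := sval x.

(* [0,1] with the trace of the Borel sigma-algebra of R *)
Definition I01 := g_sigma_algebra_preimageType I01_val.

HB.instance Definition _ := Measurable.on I01.

Lemma I01_val_inj : injective I01_val.
Proof. exact: val_inj. Qed.

Lemma image_I01_val (B : set R) :
  (I01_val : I01 -> R) @` (I01_val @^-1` B) = B `&` `[0, 1].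
Proof.
apply/seteqP; split => [_ [x Bx <-]|x [Bx]] /=.
  by split => //=; rewrite in_itv/=; exact: (valP x).
by rewrite in_itv/= => x01; exists (exist _ x x01).
Qed.

Lemma measurable_image_I01 (A : set I01) : measurable A ->
  measurable ((I01_val : I01 -> R) @` A).
Proof.
move=> [B mB]; rewrite setTI => <-; rewrite image_I01_val.
by apply: measurableI => //; exact: measurable_itv.
Qed.

Definition mu01 (A : set I01) : \bar R :=
  lebesgue_measure ((I01_val : I01 -> R) @` A).

Let mu01_0 : mu01 set0 = 0%E.
Proof. by rewrite /mu01 image_set0 measure0. Qed.

Let mu01_ge0 A : (0 <= mu01 A)%E.
Proof. exact: measure_ge0. Qed.

Let mu01_sigma_additive : semi_sigma_additive mu01.
Proof.
move=> F mF tF mUF; rewrite /mu01 image_bigcup.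
apply: measure_semi_sigma_additive.
- by move=> i; exact: measurable_image_I01.
- apply/trivIsetP => i j _ _ ij; apply/seteqP; split => // _ [[x Fx <-] [y Fy]].
  move=> /I01_val_inj yx; have := (trivIsetP.1 tF) i j Logic.I Logic.I ij.
  by move=> /seteqP[+ _] => /(_ x); apply; split => //; rewrite -yx.
- by rewrite -image_bigcup; exact: measurable_image_I01.
Qed.

HB.instance Definition _ := isMeasure.Build _ I01 R mu01
  mu01_0 mu01_ge0 mu01_sigma_additive.

Let mu01_setT : mu01 setT = 1%E.
Proof.
rewrite /mu01 -(preimage_setT (I01_val : I01 -> R)) image_I01_val setTI.
by rewrite lebesgue_measure_itv/= lte_fin ltr01 oppr0 adde0.
Qed.

HB.instance Definition _ := Measure_isProbability.Build _ I01 R mu01 mu01_setT.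

End unit_interval.

(* Elements of H = L^2([0,1]) are handled through their representatives
   f : [0,1] -> R with f \in Lfun mu01 2; patterns, observed parts and Gaussian
   processes refer to the values of these representatives *)
Section hilbert_valued.
Context {R : realType}.
Local Notation I := (I01 R).
Local Notation mu := (@mu01 R).

Definition eL2norm (f : I -> R) : \bar R := ('N[mu]_2%:E [EFin \o f])%E.

Definition L2norm (f : I -> R) : R := fine (eL2norm f).

(* For the separable space H, a measurable map into H is the same thing as
   (the class of) a jointly measurable field with square-integrable sections *)
Definition random_element d (T : measurableType d) (X : T -> I -> R) :=
  measurable_fun [set: T * I] (fun p => X p.1 p.2) /\
  forall t, X t \in Lfun mu 2%:E.

(* X is Bochner integrable with integral h: simple functions s_k converge to X
   in L^1(P; H) and their integrals converge to h in H *)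
Definition bochner_integral d (T : measurableType d)
    (P : {measure set T -> \bar R}) (X : T -> I -> R) (h : I -> R) :=
  h \in Lfun mu 2%:E /\
  exists (N : nat -> nat) (A : nat -> nat -> set T) (a : nat -> nat -> I -> R),
  [/\ forall k i, measurable (A k i) /\ (P (A k i) < +oo)%E,
      forall k i, a k i \in Lfun mu 2%:E,
      (fun k => \int[P]_t
        eL2norm (fun x => X t x - \sum_(i < N k) \1_(A k i) t * a k i x)%R)%E
        @ \oo --> 0%E &
      (fun k =>
        eL2norm (fun x => \sum_(i < N k) fine (P (A k i)) * a k i x - h x))
        @ \oo --> 0%E].

(* Y is a version of the H-valued (Bochner) conditional expectation of X given
   the sigma-algebra generated by the sets in S *)
Definition cond_expectation_H d (T : measurableType d)
    (P : {measure set T -> \bar R}) (S : set (set T)) (X Y : T -> I -> R) :=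
  @random_element _ (g_sigma_algebraType S) Y /\
  forall A : set T, <<s S >> A -> exists h : I -> R,
    bochner_integral P (fun t x => \1_A t * X t x) h /\
    bochner_integral P (fun t x => \1_A t * Y t x) h.

Definition cond_expectation d (T : measurableType d)
    (P : {measure set T -> \bar R}) (S : set (set T)) (X Y : T -> R) :=
  [/\ P.-integrable setT (EFin \o X),
      P.-integrable setT (EFin \o Y),
      measurable_fun setT (Y : g_sigma_algebraType S -> R) &
      forall A : set T, <<s S >> A ->
        (\int[P]_(t in A) (X t)%:E = \int[P]_(t in A) (Y t)%:E)%E].

(* preimages of the open balls of H, which generate its Borel sigma-algebra *)
Definition ball_preimages (T : Type) (X : T -> I -> R) : set (set T) :=
  [set A | exists (h : I -> R) (r : R), h \in Lfun mu 2%:E /\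
     A = [set t | L2norm (fun x => X t x - h x) < r]].

(* the normal law N(0, s^2); the library's normal_prob is not a Dirac mass for
   s = 0 *)
Definition centered_normal (s : R) (B : set R) : \bar R :=
  if s == 0 then dirac (0 : R) B else normal_prob 0 s B.

(* under rho, G is a Gaussian process indexed by [0,1], centered at 0 and with
   covariance function K *)
Definition gaussian_process d (Z : measurableType d)
    (rho : {measure set Z -> \bar R}) (G : Z -> I -> R) (K : I -> I -> R) :=
  [/\ forall x, measurable_fun setT (G ^~ x),
      forall (k : nat) (x : 'I_k -> I) (a : 'I_k -> R), exists s : R,
        forall B : set R, measurable B ->
        rho ((fun z => \sum_(i < k) a i * G z (x i)) @^-1` B) =
        centered_normal s B &
      forall x y, (\int[rho]_z (G z x * G z y)%:E = (K x y)%:E)%E].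

End hilbert_valued.

Section probability_notions.
Context {R : realType}.

(* the measure algebra of P is a separable metric space; this holds for every
   probability P as soon as the sigma-algebra is countably generated *)
Definition separable_measure d (T : measurableType d)
    (P : {measure set T -> \bar R}) :=
  exists D : nat -> set T, (forall k, measurable (D k)) /\
  forall (A : set T) (e : R), measurable A -> 0 < e ->
    exists k, (P ((A `\` D k) `|` (D k `\` A)) < e%:E)%E.

(* mutual independence of the H-valued random elements X j, j \in J, through
   the sigma-algebras that they generate *)
Definition independent_elements d (T : measurableType d)
    (Q : {measure set T -> \bar R}) (A : eqType) (J : set A)
    (X : A -> T -> I01 R -> R) :=
  forall (s : seq A) (E : A -> set T), uniq s ->
    (forall j, j \in s -> J j /\ <<s ball_preimages (X j) >> (E j)) ->
    (Q (\big[setI/setT]_(j <- s) E j) = \prod_(j <- s) Q (E j))%E.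

Section semidirect_product.
Context d1 d2 (X : measurableType d1) (Y : measurableType d2).
Variables (P : probability X R) (k : R.-pker X ~> Y).

(* the law of (x, y) when x has law P and y has law k x given x *)
Definition semidirect (A : set (X * Y)) : \bar R :=
  (\int[P]_x k x (xsection A x))%E.

Let semidirect0 : semidirect set0 = 0%E.
Proof.
rewrite /semidirect; apply: integral0_eq => x _.
by rewrite xsection0 measure0.
Qed.

Let semidirect_ge0 A : (0 <= semidirect A)%E.
Proof. by apply: integral_ge0 => x _; exact: measure_ge0. Qed.

Let semidirect_sigma_additive : semi_sigma_additive semidirect.
Proof.
move=> F mF tF mUF.
have mFx i x : measurable (xsection (F i) x) by exact: measurable_xsection.
rewrite [X in _ --> X](_ : _ = \sum_(i <oo) semidirect (F i))%E.
  by apply: is_cvg_ereal_nneg_natsum => n _; exact: semidirect_ge0.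
rewrite /semidirect -integral_nneseries//; last first.
- move=> n; apply: (measurable_fun_xsection_finite_kernel k).
  by rewrite inE; exact: mF.
apply: eq_integral => x _; rewrite xsection_bigcup.
apply/esym/cvg_lim => //; apply: measure_semi_sigma_additive => //.
- exact: trivIset_xsection.
- by rewrite -xsection_bigcup; exact: measurable_xsection.
Qed.

HB.instance Definition _ := isMeasure.Build _ _ R semidirect
  semidirect0 semidirect_ge0 semidirect_sigma_additive.

Let semidirect_setT : semidirect setT = 1%E.
Proof.
rewrite /semidirect -[RHS](@probability_setT _ _ _ P).
rewrite -[RHS]mul1e -(@integral_cst _ _ _ P _ measurableT).
by apply: eq_integral => x _; rewrite -setXTT in_xsectionX ?inE// prob_kernel.
Qed.

HB.instance Definition _ :=
  Measure_isProbability.Build _ _ R semidirect semidirect_setT.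

End semidirect_product.
End probability_notions.

Section missing_data.
Context {R : realType} d1 d2 d3 {Omega : measurableType d1}
  {Mis : measurableType d2} {Z : measurableType d3}.
Local Notation I := (I01 R).
Implicit Types (pat : Mis -> I -> bool) (chi : Omega -> I -> R).

Definition X1 pat (M : Mis) : set I := [set x | pat M x].
Definition X0 pat (M : Mis) : set I := [set x | ~~ pat M x].

(* f and g have the same observed part: f = g on X1 M *)
Definition same_observed pat (M : Mis) (f g : I -> R) :=
  {in X1 pat M, f =1 g}.

(* generates the sigma-algebra of w |-> O(chi w) = (chi w)|_(X1 M), the
   coarsest one for which all observed values are measurable *)
Definition observed_events pat chi (M : Mis) : set (set Omega) :=
  [set A | exists x, X1 pat M x /\
     exists B : set R, measurable B /\ A = (chi ^~ x) @^-1` B].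

(* the imputed data chi'(w, M, -); the element z is the randomness of the
   Gaussian draw *)
Definition imputed pat chi (c : Omega * Mis -> I -> R) (G : Z -> I -> R)
    (s : (Omega * Mis) * Z) : I -> R :=
  fun x => chi s.1.1 x * \1_(X1 pat s.1.2) x +
           (c s.1 x + G s.2 x) * \1_(X0 pat s.1.2) x.

(* hence the observed part of chi' is the one of chi, and conditioning on
   O(chi') in the definition of chi' is not circular *)
Lemma imputed_observed pat chi c G w M z :
  same_observed pat M (imputed pat chi c G ((w, M), z)) (chi w).
Proof.
move=> x; rewrite inE /X1/= => Mx; rewrite /imputed/= !indicE.
rewrite mem_set// memNset ?mulr1 ?mulr0 ?addr0//.
by rewrite /X0/= Mx.
Qed.

(* the joint law of (w, M) and of the Gaussian draw *)
Definition joint_law (P : probability Omega R) (nu : R.-pker Omega ~> Mis)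
    (gam : R.-pker (Omega * Mis)%type ~> Z) :
    probability ((Omega * Mis) * Z)%type R :=
  semidirect (semidirect P nu) gam.

(* c (w, M) = E[chi(w', -) | w, M] *)
Definition is_cond_mean (P : {measure set Omega -> \bar R}) pat chi
    (c : Omega * Mis -> I -> R) :=
  forall M, cond_expectation_H P (observed_events pat chi M) chi
              (fun w => c (w, M)).

(* K (w, M) is the conditional covariance of chi(w', -) given the observed
   part; under the standing integrability assumption the conditional
   covariance of (chi(x), chi(y)) exists for almost every (x, y) *)
Definition is_cond_cov (P : {measure set Omega -> \bar R}) pat chi
    (c : Omega * Mis -> I -> R) (K : Omega * Mis -> I -> I -> R) :=
  forall M, {ae (@mu01 R \x @mu01 R)%E, forall p : I * I,
    cond_expectation P (observed_events pat chi M)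
      (fun w => (chi w p.1 - c (w, M) p.1) * (chi w p.2 - c (w, M) p.2))
      (fun w => K (w, M) p.1 p.2)}.

(* nu(M | w) is the mass of the single pattern M; mu_ext k [set M] is k [set M] as soon as [set M] is
   measurable, and the infimum of k over the measurable sets containing M
   otherwise *)
Definition missing_at_random (nu : R.-pker Omega ~> Mis) pat chi :=
  forall w1 w2 M, same_observed pat M (chi w1) (chi w2) ->
    mu_ext (nu w1) [set M] = mu_ext (nu w2) [set M].

End missing_data.

(* Main.v *)
Require Import Defs.
From HB Require Import structures.
From mathcomp Require Import all_boot all_order all_algebra.
From mathcomp Require Import all_classical all_reals all_analysis.
From mathcomp Require Import measurable_realfun.

Set Implicit Arguments.
Unset Strict Implicit.
Unset Printing Implicit Defensive.
Import Order.TTheory GRing.Theory Num.Theory.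
Import numFieldNormedType.Exports.

Local Open Scope classical_set_scope.
Local Open Scope ring_scope.

(* Lyapunov's condition implies Lindeberg's: with N the L^2 norm of an imputed
   element, N^2 <= eps^(-delta) N^(2 + delta) on the event N > eps, so the truncated
   second moments are bounded by a constant multiple of the moments of order
   2 + delta. *)

(** Joint measurability of the field is what makes this work: by Tonelli, integrating [X t x]
    squared over [x] leaves a measurable function of [t]. The square root and [fine] are then
    measurable post-compositions. *)
Lemma measurable_L2norm (R : realType) (d : measure_display)
  (T : measurableType d) (X : T -> I01 R -> R) :
  random_element X -> measurable_fun setT (fun t => L2norm (X t)).
Proof.
move=> [mX _]; rewrite /L2norm /eL2norm unlock.
apply: (@measurableT_comp _ _ _ _ _ _ fine setT
  (fun t => (\int[mu01 (R:=R)]_x (`|(X t x)%:E| `^ 2)) `^ 2^-1)%E).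
  exact: fine_measurable.
apply: (@measurableT_comp _ _ _ _ _ _ (fun y : \bar R => poweR y (2^-1)) setT
  (fun t => \int[mu01 (R:=R)]_x (`|(X t x)%:E| `^ 2))%E).
  exact: measurable_poweR.
(* Tonelli applies because the integrand is nonnegative and [mu01] is a probability, hence
   sigma-finite. *)
apply: (measurable_fun_fubini_tonelli_F (m2 := mu01 (R:=R))
  (fun p : T * I01 R => (`|(X p.1 p.2)%:E| `^ 2)%E)).
  apply: (@measurableT_comp _ _ _ _ _ _ (fun y : \bar R => poweR y 2) setT
    (fun p : T * I01 R => `|(X p.1 p.2)%:E|%E)).
    exact: measurable_poweR.
  by apply: measurableT_comp => //; exact/measurable_EFinP.
by move=> p; exact: poweR_ge0.
Qed.

Lemma sqr_truncated_le_powR (R : realType) (N eps delta : R) :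
  0 <= N -> 0 < eps -> 0 < delta ->
  N ^+ 2 * (eps < N)%R%:R <= (eps `^ delta)^-1 * N `^ (2 + delta).
Proof.
move=> N0 e0 d0; have [eN|_] := ltP eps N; last first.
  by rewrite mulr0 mulr_ge0// ?invr_ge0 powR_ge0.
(* On [eps < N] the claim becomes [N ^+ 2] times [eps]^ delta[at most]N ^+ 2[times]N [^ delta].
   Splitting the power is legitimate since the total exponent [2 + delta] is nonzero. *)
rewrite mulr1 mulrC ler_pdivlMr ?powR_gt0// powRD; last first.
  by rewrite gt_eqF// addr_gt0.
rewrite powR_mulrn// ler_wpM2l ?exprn_ge0//.
by rewrite ge0_ler_powR ?nnegrE// ltW.
Qed.

Lemma expectation_sqr_truncated_le (R : realType) (d : measure_display)
  (T : measurableType d) (P : probability T R) (N : T -> R) (eps delta : R) :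
  measurable_fun setT N -> (forall t, 0 <= N t) -> 0 < eps -> 0 < delta ->
  (expectation P (fun t => N t ^+ 2 * \1_[set t' | (N t' > eps)%R] t)%R <=
   (eps `^ delta)^-1%:E * expectation P (fun t => N t `^ (2 + delta))%R)%E.
Proof.
move=> mN N0 e0 d0; rewrite unlock.
have mNd : measurable_fun setT (fun t => N t `^ (2 + delta)).
  exact: (measurableT_comp (measurable_powR (2 + delta)) mN).
rewrite -ge0_integralZl//; last 3 first.
- exact/measurable_EFinP.
- by move=> t _; rewrite lee_fin powR_ge0.
- by rewrite lee_fin invr_ge0 powR_ge0.
apply: ge0_le_integral => //.
- by move=> t _; rewrite lee_fin mulr_ge0// exprn_ge0.
- apply/measurable_EFinP; apply: measurable_funM.
    exact: measurable_funX.
  apply: measurable_indic.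
  (* The truncation event is the preimage of [true] under the boolean test [eps < N t]. *)
  have := measurable_fun_ltr (measurable_cst eps) mN.
  by move=> /(_ measurableT [set true] Logic.I); rewrite setTI.
- apply/measurable_EFinP; apply: measurable_funM => //; exact: measurable_cst.
- move=> t _; rewrite -EFinM lee_fin indicE.
  rewrite (_ : (t \in _) = (eps < N t)); last by apply/idP/idP; rewrite inE.
  exact: sqr_truncated_le_powR.
Qed.

Theorem theorem4 (R : realType) (d1 d2 d3 d4 : measure_display)
  (Omega : measurableType d1) (Mis : measurableType d2)
  (Z : measurableType d3) (Theta : measurableType d4)
  (P : nat -> nat -> probability Omega R)
  (chi : nat -> nat -> Omega -> I01 R -> R)
  (pat : Mis -> I01 R -> bool)
  (nu : nat -> nat -> R.-pker Omega ~> Mis)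
  (c : nat -> nat -> Omega * Mis -> I01 R -> R)
  (K : nat -> nat -> Omega * Mis -> I01 R -> I01 R -> R)
  (G : nat -> nat -> Z -> I01 R -> R)
  (gam : nat -> nat -> R.-pker (Omega * Mis)%type ~> Z)
  (Q : probability Theta R)
  (S : nat -> nat -> {mfun Theta >-> ((Omega * Mis) * Z)%type})
  (sepOmega : forall n m, (0 < m <= n)%N -> separable_measure (P n m))
  (chiH : forall n m, (0 < m <= n)%N -> random_element (chi n m))
  (chi_mean0 : forall n m, (0 < m <= n)%N ->
    bochner_integral (P n m) (chi n m) (fun=> 0))
  (chi_cov : forall n m, (0 < m <= n)%N ->
    (\int[(P n m \x @mu01 R) \x @mu01 R]_p
       `|chi n m p.1.1 p.1.2 * chi n m p.1.1 p.2|%:E < +oo)%E)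
  (pat_inj : injective pat)
  (cE : forall n m, (0 < m <= n)%N -> is_cond_mean (P n m) pat (chi n m) (c n m))
  (KE : forall n m, (0 < m <= n)%N ->
    is_cond_cov (P n m) pat (chi n m) (c n m) (K n m))
  (GE : forall n m, (0 < m <= n)%N -> forall wM : Omega * Mis,
    gaussian_process (gam n m wM) (G n m) (K n m wM))
  (chi'H : forall n m, (0 < m <= n)%N ->
    random_element (imputed pat (chi n m) (c n m) (G n m)))
  (mar : forall n m, (0 < m <= n)%N -> missing_at_random (nu n m) pat (chi n m))
  (S_law : forall n m, (0 < m <= n)%N -> forall A, measurable A ->
    distribution Q (S n m) A = joint_law (P n m) (nu n m) (gam n m) A)
  (chi_indep : independent_elements Q [set p : nat * nat | (0 < p.2 <= p.1)%N]
    (fun p t => chi p.1 p.2 (S p.1 p.2 t).1.1))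
  (chi'_indep : independent_elements Q [set p : nat * nat | (0 < p.2 <= p.1)%N]
    (fun p t => imputed pat (chi p.1 p.2) (c p.1 p.2) (G p.1 p.2) (S p.1 p.2 t))) :
  let E' n m := expectation (joint_law (P n m) (nu n m) (gam n m)) in
  let norm' n m s := L2norm (imputed pat (chi n m) (c n m) (G n m) s) in
  (exists delta' : R, 0 < delta' /\
    (fun n : nat => \sum_(1 <= m < n.+1)
       E' n m (fun s => (norm' n m s `^ (2 + delta'))%R))%E @ \oo --> 0%E) ->
  forall eps : R, 0 < eps ->
    (fun n : nat => \sum_(1 <= m < n.+1)
       E' n m (fun s => (norm' n m s ^+ 2 * \1_[set s' | norm' n m s' > eps] s)%R))%E
      @ \oo --> 0%E.
Proof.
move=> E' norm' [delta [d0 lyapunov]] eps e0.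
have norm'_ge0 n m s : 0 <= norm' n m s by apply: fine_ge0; exact: Lnorm_ge0.
have E'_ge0 n m f : (forall s, 0 <= f s) -> (0 <= E' n m f)%E.
  by move=> f0; rewrite /E' unlock; apply: integral_ge0 => s _; rewrite lee_fin.
(* The factor depends on neither [n] nor [m], and it is finite, so the scaled Lyapunov sums still
   tend to 0 and can serve as the upper bound of a squeeze. *)
have := cvgeZl (y := (eps `^ delta)^-1%:E) isT lyapunov.
rewrite mule0 => bound.
apply: (squeeze_cvge _ (cvg_cst 0%E) bound).
apply: nearW => n; apply/andP; split.
  apply: sume_ge0 => m _; apply: E'_ge0 => s.
  by rewrite mulr_ge0// exprn_ge0.
(* Moments may be infinite, so distributing the constant over the sum in the extended reals relies
   on their nonnegativity. *)
rewrite ge0_sume_distrr; last first.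
  by move=> m _; apply: E'_ge0 => s; exact: powR_ge0.
(* The range of [m] is kept as a side condition of the sums: [chi'H] gives measurability only for
   [0 < m <= n]. *)
rewrite [leLHS]big_nat_cond [leRHS]big_nat_cond.
apply: lee_sum => m; rewrite andbT ltnS => mn.
apply: expectation_sqr_truncated_le => //.
exact/measurable_L2norm/chi'H.
Qed.
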